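(* Let $F=\{1/n: n\in\mathbb{N}\}\cup\{0\}$ and, for $m\in\mathbb{N}$, let $$F_m=\{a_1+\cdots+a_m:\ a_i\in F,\ 1\le i\le m\}$$ be the $m$-fold arithmetic sum of $F$. Then for every $m\in\mathbb{N}$ the Minkowski dimension of $F_m$ exists and $$\dim_{\rm M}F_m=1-\frac1{2^m}.$$
   Context: $\mathbb{N}$ is the set of positive integers. Minkowski dimension: for a non-empty bounded set $\Omega\subset\mathbb{R}$ and $r>0$, let $\mathcal{N}_r(\Omega)$ be the smallest number of closed intervals of length $r$ needed to cover $\Omega$. Put $\overline{\dim}_{\rm M}\Omega=\limsup_{r\to0^+}\frac{\log \mathcal{N}_r(\Omega)}{-\log r}$ and $\underline{\dim}_{\rm M}\Omega=\liminf_{r\to0^+}\frac{\log \mathcal{N}_r(\Omega)}{-\log r}$. If they coincide, the common value is the Minkowski dimension $\dim_{\rm M}\Omega$. *)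

(* Defs.v *)
From mathcomp Require Import all_boot all_order all_algebra.
From mathcomp Require Import all_classical all_reals all_analysis.

Set Implicit Arguments.
Unset Strict Implicit.
Unset Printing Implicit Defensive.

Import Order.TTheory GRing.Theory Num.Theory.
Import numFieldNormedType.Exports.

Local Open Scope classical_set_scope.
Local Open Scope ring_scope.

Definition covered_by_intervals (R : realType) (r : R) (A : set R) (k : nat) : Prop :=
  exists c : 'I_k -> R, A `<=` [set x | exists i, x \in `[c i, c i + r]].

(* Total: the value is 0 when no finite cover exists, which cannot happen
   for bounded A and r > 0. *)
Definition covering_number (R : realType) (r : R) (A : set R) : nat :=
  xget 0%N [set k | covered_by_intervals r A k /\
                    forall j, covered_by_intervals r A j -> (k <= j)%N].

Definition log_ratio (R : realType) (A : set R) (r : R) : \bar R :=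
  (ln (covering_number r A)%:R / - ln r)%:E.

Definition upper_minkowski_dim (R : realType) (A : set R) : \bar R :=
  limf_esup (log_ratio A) 0^'+.

Definition lower_minkowski_dim (R : realType) (A : set R) : \bar R :=
  limf_einf (log_ratio A) 0^'+.

(* Both dimensions above are meaningful only on non-empty bounded sets. *)
Definition has_minkowski_dim (R : realType) (A : set R) (d : R) : Prop :=
  [/\ A !=set0, bounded_set A,
      upper_minkowski_dim A = d%:E & lower_minkowski_dim A = d%:E].

Definition inv_nat_set (R : realType) : set R :=
  [set n%:R^-1 | n in [set n : nat | (0 < n)%N]] `|` [set 0].

Arguments inv_nat_set : clear implicits.

Definition fold_sumset (R : realType) (A : set R) (m : nat) : set R :=
  [set \sum_(i < m) a i | a in [set a : 'I_m -> R | forall i, A (a i)]].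

(* Main.v *)
(** Upper bound for r = t^(2^m): a sum in which every term is at most t lies in
    [0, m t], which needs about m t / r intervals; otherwise some term is one of
    the at most 1/t numbers 1/n > t, and the sum of the remaining m - 1 terms
    lies in F_(m-1), which by induction, as r = (t^2)^(2^(m-1)), is covered by
    O(t^2 / r) intervals.  Both contributions are O(t / r).
    Lower bound: every x in [0, 1] has an element of F in [x - x^2, x], so greedy
    approximation yields an element of F_m in [x - x^(2^m), x].  Hence F_m is
    r-dense in [0, t], and t = O(r N_r(F_m)). *)
Require Import Defs.
From mathcomp Require Import all_boot all_order all_algebra.
From mathcomp Require Import all_classical all_reals all_analysis.
From mathcomp Require Import ring lra.

Import Order.TTheory GRing.Theory Num.Theory.
Import numFieldNormedType.Exports.

Local Open Scope classical_set_scope.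
Local Open Scope ring_scope.

(** * Upper and lower limits along a proper filter *)

Section limsup_liminf.
Variables (R : realType) (F : set_system R).
Context {FF : ProperFilter F}.
Implicit Types (f : R -> R) (d : R).

(** The upper limit is an infimum of suprema over members of [F]. The member where [f x <= d + e]
    bounds it above; below, every member meets [|d - f x| < e] because [F] is proper. *)
Lemma limf_esup_cvg f d : f x @[x --> F] --> d ->
  limf_esup (fun x => (f x)%:E) F = d%:E.
Proof.
move=> fd; rewrite limf_esupE; apply/eqP; rewrite eq_le; apply/andP; split.
- apply/lee_addgt0Pr => e e0.
  have Fe : F [set x | f x <= d + e].
    have : \forall x \near F, `|d - f x| < e by move/cvgrPdist_lt : fd; apply.
    by apply: filterS => x /=; rewrite ltr_norml => /andP[h1 h2]; lra.
  apply: (@le_trans _ _ (ereal_sup [set (f x)%:E | x in [set x | f x <= d + e]])).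
    by apply: ereal_inf_lbound; exists [set x | f x <= d + e].
  by apply: ge_ereal_sup => _ [x /= hx <-]; rewrite -EFinD lee_fin.
- apply: le_ereal_inf_tmp => _ [V FV <-]; apply/lee_addgt0Pr => e e0.
  have Fe : F [set x | `|d - f x| < e] by move/cvgrPdist_lt : fd; apply.
  have [x [Vx /=]] : exists x, (V `&` [set x | `|d - f x| < e]) x.
    exact: (filter_ex (filterI FV Fe)).
  rewrite ltr_norml => /andP[h1 h2].
  apply: (@le_trans _ _ ((f x)%:E + e%:E)%E).
    by rewrite -EFinD lee_fin; lra.
  by rewrite leeD2r//; apply: ereal_sup_ubound; exists x.
Qed.

Lemma limf_einf_cvg f d : f x @[x --> F] --> d ->
  limf_einf (fun x => (f x)%:E) F = d%:E.
Proof.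
move=> fd; rewrite /limf_einf.
have -> : (\- (fun x => (f x)%:E))%E = (fun x => (- f x)%:E) by [].
rewrite (@limf_esup_cvg (fun x => - f x) (- d)) ?EFinN ?oppeK//.
exact: cvgN.
Qed.

End limsup_liminf.

(** * Covering numbers of sets of reals *)

Section covers.
Variable R : realType.
Implicit Types (r t x : R) (A : set R) (s : seq R) (k : nat).

(** One finite cover yields a least one by well-ordering, so [xget] does not fall back on its
    default 0. *)
Lemma covering_number_min r A k : covered_by_intervals r A k ->
  covered_by_intervals r A (covering_number r A) /\ (covering_number r A <= k)%N.
Proof.
move=> Ak.
have ex : exists n, `[< covered_by_intervals r A n >] by exists k; apply/asboolP.
have [n /asboolP An nmin] := ex_minnP ex.
have : [set n | covered_by_intervals r A n /\
    forall j, covered_by_intervals r A j -> (n <= j)%N] (covering_number r A).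
  apply: xgetPex; exists n; split => // j Aj.
  by apply: nmin; apply/asboolP.
by case=> cov mini; split=> //; exact: mini.
Qed.

Lemma covered_by_seq r A s :
  (forall x, A x -> exists2 c, c \in s & c <= x <= c + r) ->
  covered_by_intervals r A (size s).
Proof.
move=> As; exists (tnth (in_tuple s)) => x /As[c /= cs cx].
have /tnthP[i ci] : c \in in_tuple s by [].
by exists i; rewrite -ci in_itv.
Qed.

Lemma covered_segment r t : 0 < r -> 0 <= t ->
  exists s, (size s)%:R * r <= t + r /\
    (forall x, 0 <= x <= t -> exists2 c, c \in s & c <= x <= c + r).
Proof.
move=> r0 t0; have tr0 : 0 <= t / r by rewrite divr_ge0// ltW.
exists [seq j%:R * r | j <- iota 0 (Num.trunc (t / r)).+1]; split.
  rewrite size_map size_iota -natr1 mulrDl mul1r lerD2r -ler_pdivlMr//.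
  by have /andP[] := truncn_itv tr0.
move=> x /andP[x0 xt]; have xr0 : 0 <= x / r by rewrite divr_ge0// ltW.
have /andP[h1 h2] := truncn_itv xr0.
exists ((Num.trunc (x / r))%:R * r).
  apply: (map_f (fun j : nat => j%:R * r)); rewrite mem_iota /= add0n ltnS.
  by apply: le_truncn; rewrite ler_pM2r ?invr_gt0.
rewrite -ler_pdivlMr// h1 /= -[X in _ + X]mul1r -mulrDl natr1.
by rewrite -ler_pdivrMr// ltW.
Qed.

(** If [3 * r * k < t], the [k + 1] points [3 * r * j] lie in [[0, t]], each at most [r] above a
    point of [A]. Points served by the same interval differ by at most [2 * r], so [k + 1] points
    would inject into [k] intervals. *)
Lemma dense_covering_lower r t A k : 0 < r ->
  (forall x, 0 <= x <= t -> exists2 y, A y & y <= x <= y + r) ->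
  covered_by_intervals r A k -> t <= 3 * r * k%:R.
Proof.
move=> r0 dense [c Ac]; rewrite leNgt; apply/negP => kt.
have pick (j : 'I_k.+1) : exists i,
    c i <= 3 * r * j%:R <= c i + r + r.
  have [|y /Ac[i /=]] := dense (3 * r * j%:R).
    rewrite !mulr_ge0 ?(ltW r0)//=; apply: le_trans (ltW kt).
    by rewrite ler_pM2l ?mulr_gt0// ler_nat -ltnS.
  rewrite in_itv /= => /andP[h1 h2] /andP[h3 h4]; exists i; lra.
have [f fP] := choice pick.
have f_inj : injective f.
  suff lef (j j' : 'I_k.+1) : f j = f j' -> (j <= j')%N.
    by move=> j j' e; apply/val_inj/eqP; rewrite eqn_leq !lef.
  move=> e; have /andP[_ h1] := fP j; have /andP[h2 _] := fP j'.
  rewrite leqNgt -(ltr_nat R) (_ : (j'%:R < j%:R) = (j'.+1%:R <= j%:R :> R)).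
    rewrite e in h1; apply/negP; rewrite -natr1 => h3.
    have : 3 * r * (j'%:R + 1) <= 3 * r * j%:R by rewrite ler_pM2l// mulr_gt0.
    by lra.
  by rewrite ltr_nat ler_nat.
by have := leq_card f f_inj; rewrite !card_ord ltnn.
Qed.

End covers.

(** * Approximation and covering of the sumsets *)

Section sumset.
Variable R : realType.
Implicit Types (A : set R) (r t x : R).

Lemma fold_sumset_cons A m x y : A x -> fold_sumset A m y ->
  fold_sumset A m.+1 (x + y).
Proof.
move=> Ax [a Aa <-].
exists (fun i => oapp a x (unlift ord0 i)).
  by move=> i /=; case: (unlift ord0 i) => //=.
rewrite big_ord_recl unlift_none /=; congr (_ + _).
by apply: eq_bigr => i _; rewrite liftK.
Qed.

Local Notation F := (inv_nat_set R).

Lemma inv_nat_set_itv x : F x -> 0 <= x <= 1.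
Proof.
move=> [[n /= n0 <-]|->]; last by rewrite lexx ler01.
by rewrite invr_ge0 ler0n invf_le1 ?ltr0n// ler1n.
Qed.

Lemma fold_inv_nat_set_itv m x : fold_sumset F m x -> 0 <= x <= m%:R.
Proof.
move=> [a Fa <-]; apply/andP; split.
  by apply: sumr_ge0 => i _; have /andP[] := inv_nat_set_itv _ (Fa i).
have -> : m%:R = \sum_(i < m) 1 :> R by rewrite sumr_const card_ord.
by apply: ler_sum => i _; have /andP[] := inv_nat_set_itv _ (Fa i).
Qed.

Lemma inv_nat_set_approx x : 0 <= x -> exists2 a, F a & a <= x <= a + x ^+ 2.
Proof.
rewrite le_eqVlt => /orP[/eqP<-|x0].
  by exists 0; [right|rewrite expr0n addr0 lexx].
have /andP[] := truncn_itv (ltW (divr_gt0 ltr01 x0)).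
(* With [n] the integer part of [1 / x], the choice [u = 1 / (n + 1)] gives [x - u = u * (n * x + x
   - 1) <= u * x <= x ^+ 2], since [n * x <= 1]. *)
set n := Num.trunc _ => h1 h2; exists n.+1%:R^-1; first by left; exists n.+1.
move: h1 h2; rewrite ler_pdivlMr// ltr_pdivrMr// -natr1 => h1 h2.
have n0 : 0 < n%:R + 1 :> R by rewrite natr1 ltr0n.
set u := _^-1; have u0 : 0 < u by rewrite invr_gt0.
have un : u * (n%:R + 1) = 1 by rewrite mulVf ?gt_eqF.
have ux : u <= x by rewrite -(ler_pM2r n0) un; lra.
have xu : x - u = u * (n%:R * x + x - 1).
  have -> : u * (n%:R * x + x - 1) = x * (u * (n%:R + 1)) - u by ring.
  by rewrite un mulr1.
rewrite ux /= -lerBlDl xu; apply: (@le_trans _ _ (u * x)).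
  by rewrite ler_pM2l//; lra.
by rewrite expr2 ler_pM2r.
Qed.

Lemma fold_sumset_approx m x : 0 <= x <= 1 ->
  exists2 y, fold_sumset F m y & y <= x <= y + x ^+ (2 ^ m).
Proof.
elim: m x => [|m IH] x /andP[x0 x1].
  exists 0; last by rewrite x0 add0r expr1 lexx.
  by exists (fun=> 0); [move=> i; right | rewrite big_ord0].
have [a Fa /andP[ax xa]] := inv_nat_set_approx x x0.
have z0 : 0 <= x - a by lra.
have zx : x - a <= x ^+ 2 by lra.
have [|y Fy /andP[yz zy]] := IH (x - a).
  by rewrite z0 /=; have /andP[] := inv_nat_set_itv _ Fa; lra.
exists (a + y); first exact: fold_sumset_cons.
(* The remainder is at most [x ^+ 2], so each greedy step doubles the exponent. *)
have : (x - a) ^+ (2 ^ m) <= x ^+ (2 ^ m.+1).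
  by rewrite expnS exprM lerXn2r// ?nnegrE ?exprn_ge0.
by lra.
Qed.

Lemma fold_sumset_covering_upper m : exists2 C : R, 0 < C &
  forall t, 0 < t <= 1 -> exists2 k,
    covered_by_intervals (t ^+ (2 ^ m)) (fold_sumset F m) k &
    k%:R * t ^+ (2 ^ m) <= C * t.
Proof.
(* Lists of left endpoints replace indexed families: the induction translates and concatenates
   them. *)
suff [C C0 CP] : exists2 C : R, 0 < C & forall t, 0 < t <= 1 -> exists2 s : seq R,
    (forall x, fold_sumset F m x ->
       exists2 c, c \in s & c <= x <= c + t ^+ (2 ^ m)) &
    (size s)%:R * t ^+ (2 ^ m) <= C * t.
  exists C => // t /CP[s cov le]; exists (size s) => //.
  exact: covered_by_seq.
elim: m => [|m [C C0 IH]].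
  exists 1 => // t /andP[t0 t1]; exists [:: 0]; last by rewrite expn0 expr1.
  move=> _ [a _ <-]; exists 0; first by rewrite mem_head.
  by rewrite big_ord0 lexx add0r expn0 expr1 ltW.
(* [C] pays for sums with a term above [t]; covering [[0, (m + 1) * t]] costs
   [(m + 1) * t + r <= (m + 2) * t]. *)
exists (C + m.+2%:R) => [|t /andP[t0 t1]]; first by rewrite addr_gt0.
set r := t ^+ (2 ^ m.+1).
have r0 : 0 < r by rewrite exprn_gt0.
have rt : r <= t.
  by rewrite /r -(prednK (expn_gt0 2 m.+1)) exprS ler_piMr ?exprn_ile1 ?(ltW t0).
have rE : (t ^+ 2) ^+ (2 ^ m) = r by rewrite -exprM -expnS.
have [|s1 s1P s1r] := IH (t ^+ 2); first by rewrite exprn_gt0// exprn_ile1// (ltW t0).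
rewrite {}rE in s1P s1r.
have mt0 : 0 <= m.+1%:R * t by rewrite mulr_ge0// ltW.
have [s2 [s2r s2P]] := covered_segment _ _ _ r0 mt0.
have tV0 : 0 <= t^-1 by rewrite invr_ge0 ltW.
have /andP[h1 h2] := truncn_itv tV0; set n := Num.trunc _ in h1 h2.
exists (s2 ++ [seq p%:R^-1 + c | p <- iota 1 n, c <- s1]); last first.
  rewrite size_cat size_allpairs size_iota natrD natrM mulrDl.
  (* At most [1 / t] translates of [s1], each of total length at most [C * t ^+ 2]. *)
  have : n%:R * (size s1)%:R * r <= t^-1 * (C * t ^+ 2).
    by rewrite -mulrA ler_pM// ?mulr_ge0// ltW.
  have -> : t^-1 * (C * t ^+ 2) = C * t by field; rewrite gt_eqF.
  by rewrite -(natr1 m.+1); lra.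
move=> _ [a Fa <-].
have [small|] := pselect (forall i, a i <= t).
  have [|c cs cx] := s2P (\sum_(i < m.+1) a i).
    rewrite sumr_ge0/=; last by move=> i _; have /andP[] := inv_nat_set_itv _ (Fa i).
    have -> : m.+1%:R * t = \sum_(i < m.+1) t by rewrite sumr_const card_ord mulr_natl.
    exact: ler_sum.
  by exists c => //; rewrite mem_cat cs.
move=> /existsNP[i /negP]; rewrite -ltNge => ta.
have [|c cs cx] := s1P (\sum_(j < m) a (lift i j)).
  by exists (fun j => a (lift i j)) => // j; exact: Fa.
exists (a i + c); last first.
  by rewrite (bigD1_ord i)//= -addrA !lerD2l.
(* As [a i > t > 0], it is some [1 / p] with [p < 1 / t], hence [p <= n]. *)
have : F (a i) by exact: Fa.
case=> [[p /= p0 pa]|a0]; last by rewrite a0 ltNge ltW in ta.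
rewrite mem_cat -pa; apply/orP; right; apply/allpairs_f => //.
rewrite mem_iota p0 add1n ltnS /n truncn_ge_nat//.
by rewrite -[p%:R]invrK pa lef_pV2 ?posrE ?ltW// (lt_trans t0).
Qed.

End sumset.

(** * From covering estimates to the dimension *)

Lemma log_ratio_cvg (R : realType) (A : set R) (d K : R) :
  (\forall r \near 0^'+,
    `|ln (covering_number r A)%:R + d * ln r| <= K) ->
  ln (covering_number r A)%:R / - ln r @[r --> 0^'+] --> d.
Proof.
move=> near_d; apply/cvgrPdist_le => e e0.
near=> r.
(* The error of the quotient is at most [K / - ln r], which this threshold brings below [e]; the
   absolute value and the 1 keep [- ln r] positive whatever the sign of [K]. *)
have r_small : ln r < - ((`|K| + 1) / e).
  by near: r; exact: (cvgrNy_lt (@lnNy R)).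
have lr0 : 0 < - ln r.
  by rewrite oppr_gt0 (lt_trans r_small)// oppr_lt0 divr_gt0// ltr_wpDl.
have -> : d - ln (covering_number r A)%:R / - ln r =
    (- (ln (covering_number r A)%:R + d * ln r)) / - ln r.
  by field; rewrite -oppr_eq0 gt_eqF.
rewrite normrM normfV normrN (gtr0_norm lr0) ler_pdivrMr//.
have : `|ln (covering_number r A)%:R + d * ln r| <= K by near: r.
move=> /le_trans; apply.
move: r_small; rewrite ltrNr ltr_pdivrMr// => h.
have := ler_norm K; lra.
Unshelve. all: by end_near.
Qed.

Theorem theorem1p4 (R : realType) (m : nat) (hm : (0 < m)%N) :
  has_minkowski_dim (fold_sumset (inv_nat_set R) m) (1 - 1 / 2 ^+ m).
Proof.
set A := fold_sumset _ _.
suff lim : ln (covering_number r A)%:R / - ln r @[r --> 0^'+] -->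
    (1 - 1 / 2 ^+ m : R).
  split; last 2 first.
  - exact: limf_esup_cvg lim.
  - exact: limf_einf_cvg lim.
  - by exists (\sum_(i < m) 0); exists (fun=> 0) => // i; right.
  - exists m%:R; split; first exact: num_real.
    move=> M mM x /fold_inv_nat_set_itv/andP[x0 xm] /=.
    by rewrite ger0_norm// (le_trans xm)// ltW.
have [C C0 CP] := @fold_sumset_covering_upper R m.
(* [ln C] comes from the upper covering bound, [ln 3] from the spacing [3 * r] in the lower one. *)
apply: (@log_ratio_cvg _ _ _ (`|ln C| + ln 3)).
near=> r.
have r0 : 0 < r by near: r; exact: nbhs_right_gt.
have r1 : r <= 1 by near: r; exact: nbhs_right_le.
pose t := r `^ (1 / 2 ^+ m).
have t0 : 0 < t by exact: powR_gt0.
have t01 : 0 < t <= 1.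
  by rewrite t0 -[leRHS](powRr0 r) ger_powR ?r0 ?divr_ge0 ?exprn_ge0.
have tr : t ^+ (2 ^ m) = r.
  rewrite -powR_mulrn ?ltW// -powRrM natrX divfK ?expf_neq0 ?pnatr_eq0//.
  by rewrite powRr1 ?ltW.
have lnt : ln t = 1 / 2 ^+ m * ln r by rewrite ln_powR.
have [k /covering_number_min[]] := CP t t01.
rewrite tr; set N := covering_number r A => covN Nk kr.
have lowN : t <= 3 * r * N%:R.
  apply: dense_covering_lower covN => // x /andP[x0 xt].
  have [|y Ay /andP[yx xy]] := @fold_sumset_approx R m x.
    by rewrite x0 (le_trans xt)//; case/andP: t01.
  exists y => //; rewrite yx (le_trans xy)// lerD2l -tr.
  by rewrite lerXn2r// nnegrE ltW.
(* Positivity of [N] is needed before taking logarithms, as [ln] is additive only on positive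
   factors. *)
have N0 : 0 < N%:R :> R.
  by have := lt_le_trans t0 lowN; rewrite pmulr_rgt0// mulr_gt0.
have upN : N%:R * r <= C * t.
  by apply: le_trans kr; rewrite ler_pM2r// ler_nat.
have : ln t <= ln (3 * r * N%:R) by rewrite ler_ln ?posrE ?mulr_gt0.
have : ln (N%:R * r) <= ln (C * t) by rewrite ler_ln ?posrE ?mulr_gt0.
rewrite !lnM ?posrE ?mulr_gt0// lnt => up low.
have ln3 : 0 <= ln (3 : R) by rewrite ln_ge0// ler1n.
have := ler_norm (ln C); have := normr_ge0 (ln C).
by move=> *; rewrite ler_norml; apply/andP; split; lra.
Unshelve. all: by end_near.
Qed.
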